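(* Let $B>0$, let $d\ge1$ be an integer, and let $n=n_0,n_1,\dots,n_{d-1},n_d=k$ be positive integers. For $w=\mathrm{vec}(\{W_i\}_{i=1}^d)$ with $W_i\in\mathbb{R}^{n_i\times n_{i-1}}$, let $f_w:\mathcal{X}_{B,n}\to\mathbb{R}^k$ be the $d$-layer neural network with ReLU activations, $f_w(x)=W_d\,\phi(W_{d-1}\,\phi(\cdots\phi(W_1x)))$. Then for any $w$ (with every $W_i\ne 0$), any $x\in\mathcal{X}_{B,n}$, and any perturbation $u=\mathrm{vec}(\{U_i\}_{i=1}^d)$ with $U_i\in\mathbb{R}^{n_i\times n_{i-1}}$ such that $\|U_i\|_2\le\frac1d\|W_i\|_2$ for all $1\le i\le d$, $$|f_{w+u}(x)-f_w(x)|_2\le eB\left(\prod_{i=1}^d\|W_i\|_2\right)\sum_{i=1}^d\frac{\|U_i\|_2}{\|W_i\|_2}.$$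
   Context: $\mathcal{X}_{B,n}=\{x\in\mathbb{R}^n : \sum_{i=1}^n x_i^2\le B^2\}$. $\phi(t)=\max(t,0)$ is the ReLU function, applied coordinatewise (for $d=1$, $f_w(x)=W_1x$). $\|\cdot\|_2$ is the spectral (operator) norm of a matrix, $|\cdot|_2$ is the Euclidean norm of a vector, and $e$ is the base of the natural logarithm. $f_{w+u}$ is the network with weight matrices $W_i+U_i$. *)

(* Defs.v *)
From HB Require Import structures.
From mathcomp Require Import all_boot all_order all_algebra.
From mathcomp Require Import all_classical all_reals all_analysis.

Set Implicit Arguments.
Unset Strict Implicit.
Unset Printing Implicit Defensive.

Import Order.TTheory GRing.Theory Num.Theory.

Local Open Scope classical_set_scope.
Local Open Scope ring_scope.

(* The library norm `|x| on matrices is the maximum norm of the entries, so the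
   Euclidean norm of a column vector and the spectral norm are defined here. *)
Definition norm2 (R : realType) (n : nat) (x : 'cV[R]_n) : R :=
  Num.sqrt (\sum_(i < n) x i 0 ^+ 2).

(* The supremum is taken in R; its set contains 0 and is bounded above, so the
   default value of sup on other sets plays no role. *)
Definition spectral_norm (R : realType) (m n : nat) (A : 'M[R]_(m, n)) : R :=
  sup [set norm2 (A *m x) | x in [set x : 'cV[R]_n | norm2 x <= 1]].

Definition input_domain (R : realType) (B : R) (n : nat) : set 'cV[R]_n :=
  [set x | \sum_(i < n) x i 0 ^+ 2 <= B ^+ 2].
Arguments input_domain {R} B n.

Definition relu (R : realType) (t : R) : R := Num.max t 0.

(* Layers are numbered from 0: W i, of format n (i + 1) x n i, is the matrix
   written W_(i+1) when they are numbered from 1. Only the values n 0, ..., n d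
   of the width function n are ever used. *)
Definition weights (R : realType) (d : nat) (n : nat -> nat) : Type :=
  forall i : 'I_d, 'M[R]_(n i.+1, n i).

Definition perturb (R : realType) (d : nat) (n : nat -> nat)
    (W U : weights R d n) : weights R d n :=
  fun i => W i + U i.

Definition init_weights (R : realType) (d : nat) (n : nat -> nat)
    (W : weights R d.+1 n) : weights R d n :=
  fun i => W (widen_ord (leqnSn d) i).

(* phi (W_d (phi (... phi (W_1 x)))): the activation follows every layer. *)
Fixpoint hidden (R : realType) (n : nat -> nat) (d : nat) :
    weights R d n -> 'cV[R]_(n 0%N) -> 'cV[R]_(n d) :=
  match d with
  | 0 => fun _ x => x
  | d'.+1 => fun W x =>
      map_mx (@relu R) (W ord_max *m hidden (init_weights W) x)
  end.

(* f_w: the last layer is linear, with no activation. The value at depth 0 is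
   a placeholder. *)
Definition network (R : realType) (n : nat -> nat) (d : nat) :
    weights R d n -> 'cV[R]_(n 0%N) -> 'cV[R]_(n d) :=
  match d with
  | 0 => fun _ x => x
  | d'.+1 => fun W x => W ord_max *m hidden (init_weights W) x
  end.

(* Main.v *)
Require Import Defs.
From HB Require Import structures.
From mathcomp Require Import all_boot all_order all_algebra.
From mathcomp Require Import all_classical all_reals all_analysis.
From mathcomp Require Import ring lra.

Set Implicit Arguments.
Unset Strict Implicit.

Import Order.TTheory GRing.Theory Num.Theory.

Local Open Scope classical_set_scope.
Local Open Scope ring_scope.

(** Telescoping over the layers through
    [(A + E) h' - A h = (A + E) (h' - h) + E h] bounds the error by
    [(1 + 1/d)^d |x| (prod |W_i|) (sum |U_i| / |W_i|)], the factor [1 + 1/d]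
    coming from [|A + E| <= (1 + 1/d) |A|] at each layer, and
    [(1 + 1/d)^d <= e]. The ReLU is 1-Lipschitz and fixes 0, so it does not
    increase any of the norms involved. *)

(** * Euclidean norm of column vectors *)

Lemma norm2_ge0 (R : realType) n (x : 'cV[R]_n) : 0 <= norm2 x.
Proof. exact: sqrtr_ge0. Qed.

Lemma sqr_norm2 (R : realType) n (x : 'cV[R]_n) :
  norm2 x ^+ 2 = \sum_(i < n) x i 0 ^+ 2.
Proof. by rewrite sqr_sqrtr// sumr_ge0// => i _; exact: sqr_ge0. Qed.

Lemma norm20 (R : realType) n : norm2 (0 : 'cV[R]_n) = 0.
Proof.
rewrite /norm2 big1 ?sqrtr0// => i _.
by rewrite mxE expr0n.
Qed.

Lemma norm2_eq0 (R : realType) n (x : 'cV[R]_n) : norm2 x = 0 -> x = 0.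
Proof.
move=> x0; apply/matrixP => i j; rewrite ord1 mxE; apply/eqP.
have /eqP := sqr_norm2 x; rewrite x0 expr0n eq_sym psumr_eq0 => [|k _].
  by move=> /allP/(_ i); rewrite mem_index_enum sqrf_eq0; exact.
exact: sqr_ge0.
Qed.

Lemma norm2Z (R : realType) n (a : R) (x : 'cV[R]_n) :
  norm2 (a *: x) = `|a| * norm2 x.
Proof.
rewrite /norm2 -sqrtr_sqr -sqrtrM ?sqr_ge0// mulr_sumr.
by congr Num.sqrt; apply: eq_bigr => i _; rewrite mxE exprMn.
Qed.

Lemma le_norm2 (R : realType) n (x y : 'cV[R]_n) :
  (forall i, `|x i 0| <= `|y i 0|) -> norm2 x <= norm2 y.
Proof.
move=> xy; apply: ler_wsqrtr; apply: ler_sum => i _.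
rewrite -[leLHS]real_normK ?num_real// -[leRHS]real_normK ?num_real//.
by rewrite lerXn2r ?nnegrE.
Qed.

(** For nonzero vectors, expanding the squared norm of [|y| x - |x| y] gives
    [2 |x| |y| (|x| |y| - <x, y>)], which is nonnegative; then divide by [|x| |y|]. *)
Lemma cauchy_schwarz_norm2 (R : realType) n (x y : 'cV[R]_n) :
  \sum_(i < n) x i 0 * y i 0 <= norm2 x * norm2 y.
Proof.
have [/norm2_eq0 ->|x0] := eqVneq (norm2 x) 0.
  by rewrite norm20 mul0r big1// => i _; rewrite mxE mul0r.
have [/norm2_eq0 ->|y0] := eqVneq (norm2 y) 0.
  by rewrite norm20 mulr0 big1// => i _; rewrite mxE mulr0.
have p : 0 < norm2 x * norm2 y by rewrite mulr_gt0// lt0r norm2_ge0 ?x0 ?y0.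
have : 0 <= \sum_(i < n) (norm2 y * x i 0 - norm2 x * y i 0) ^+ 2.
  by apply: sumr_ge0 => i _; exact: sqr_ge0.
rewrite (eq_bigr (fun i => norm2 y ^+ 2 * x i 0 ^+ 2 + norm2 x ^+ 2 * y i 0 ^+ 2
  - 2 * (norm2 x * norm2 y) * (x i 0 * y i 0))) => [|i _]; last by ring.
rewrite sumrB big_split/= -!mulr_sumr -!sqr_norm2 => h.
rewrite -(ler_pM2l p); lra.
Qed.

Lemma ler_norm2D (R : realType) n (x y : 'cV[R]_n) :
  norm2 (x + y) <= norm2 x + norm2 y.
Proof.
have xy := cauchy_schwarz_norm2 x y.
rewrite -(@ler_pXn2r _ 2)// ?nnegrE ?addr_ge0 ?norm2_ge0//.
rewrite sqr_norm2 (eq_bigr (fun i => x i 0 ^+ 2 + y i 0 ^+ 2 + 2 * (x i 0 * y i 0)))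
  => [|i _]; last by rewrite mxE; ring.
by rewrite !big_split/= -mulr_sumr -!sqr_norm2; lra.
Qed.

(** * Spectral norm *)

Lemma norm2_mulmx_bounded (R : realType) m n (A : 'M[R]_(m, n)) :
  exists C : R, forall x, norm2 (A *m x) <= C * norm2 x.
Proof.
(* The witness is the Frobenius norm, as the norm of the column of row norms. Scaling that column by
   [norm2 x] lets [le_norm2] reduce the claim to Cauchy-Schwarz on each row. *)
exists (norm2 (\col_i norm2 (row i A)^T)) => x.
rewrite mulrC -[leRHS](ger0_norm (mulr_ge0 (norm2_ge0 _) (norm2_ge0 _))).
rewrite normrM [X in _ * X]ger0_norm ?norm2_ge0// -norm2Z.
apply: le_norm2 => i; rewrite !mxE [leRHS]ger0_norm ?mulr_ge0 ?norm2_ge0//.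
have e (y : 'cV[R]_n) : \sum_j A i j * y j 0 = \sum_j (row i A)^T j 0 * y j 0.
  by apply: eq_bigr => j _; rewrite !mxE.
rewrite ler_norml lerNl mulrC; apply/andP; split.
  (* The lower bound on the entry is Cauchy-Schwarz for [- x]. *)
  rewrite -sumrN (eq_bigr (fun j => A i j * (- x) j 0)) => [|j _].
    have <- : norm2 (- x) = norm2 x by rewrite -scaleN1r norm2Z normrN1 mul1r.
    by rewrite e; exact: cauchy_schwarz_norm2.
  by rewrite mxE mulrN.
by rewrite e; exact: cauchy_schwarz_norm2.
Qed.

Lemma norm2_mulmx_unit_ball (R : realType) m n (A : 'M[R]_(m, n)) (x : 'cV[R]_n) :
  norm2 x <= 1 -> norm2 (A *m x) <= spectral_norm A.
Proof.
move=> x1; apply: ub_le_sup; last by exists x.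
have [C CA] := norm2_mulmx_bounded A.
(* [C] comes without a sign; bounding [norm2 y] by 1 needs a nonnegative factor. *)
exists `|C| => _ [y y1 <-]; apply: le_trans (CA y) _.
apply: le_trans (ler_wpM2r (norm2_ge0 y) (ler_norm C)) _.
by rewrite ler_piMr.
Qed.

Lemma spectral_norm_ge0 (R : realType) m n (A : 'M[R]_(m, n)) :
  0 <= spectral_norm A.
Proof.
apply: le_trans (norm2_ge0 (A *m 0)) _.
by apply: norm2_mulmx_unit_ball; rewrite norm20.
Qed.

Lemma norm2_mulmx_le (R : realType) m n (A : 'M[R]_(m, n)) (x : 'cV[R]_n) :
  norm2 (A *m x) <= spectral_norm A * norm2 x.
Proof.
have [/norm2_eq0 ->|x0] := eqVneq (norm2 x) 0.
  by rewrite mulmx0 !norm20 mulr0.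
have xp : 0 < norm2 x by rewrite lt0r x0 norm2_ge0.
have := @norm2_mulmx_unit_ball _ _ _ A ((norm2 x)^-1 *: x).
rewrite -scalemxAr !norm2Z ger0_norm ?invr_ge0 ?norm2_ge0// mulVf//.
by rewrite lexx ler_pdivrMl// [X in _ <= X]mulrC; apply.
Qed.

(** A zero norm would make [A] kill every basis vector, hence have only zero columns. This justifies
    the divisions by [spectral_norm (W i)]. *)
Lemma spectral_norm_gt0 (R : realType) m n (A : 'M[R]_(m, n)) :
  A != 0 -> 0 < spectral_norm A.
Proof.
rewrite lt0r spectral_norm_ge0 andbT; apply: contra_neq => A0.
apply/matrixP => i j; rewrite mxE.
have /norm2_eq0/matrixP/(_ i 0) : norm2 (A *m delta_mx j (0 : 'I_1)) = 0.
  apply/eqP; rewrite eq_le norm2_ge0 andbT.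
  by apply: le_trans (norm2_mulmx_le _ _) _; rewrite A0 mul0r.
by rewrite -colE !mxE.
Qed.

(** * ReLU and the size of the hidden layers *)

Lemma norm2_map_relu_le (R : realType) n (x : 'cV[R]_n) :
  norm2 (map_mx (@relu R) x) <= norm2 x.
Proof.
apply: le_norm2 => i; rewrite mxE /relu.
by case: (leP (x i 0) 0) => [_|//]; rewrite normr0.
Qed.

Lemma norm2_map_reluB_le (R : realType) n (x y : 'cV[R]_n) :
  norm2 (map_mx (@relu R) x - map_mx (@relu R) y) <= norm2 (x - y).
Proof.
apply: le_norm2 => i; rewrite !mxE /relu.
case: (leP (x i 0) 0) => hx; case: (leP (y i 0) 0) => hy //.
- by rewrite subr0 normr0.
- by rewrite sub0r normrN gtr0_norm// ltr0_norm; lra.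
- by rewrite subr0 !gtr0_norm; lra.
Qed.

Lemma hidden_le (R : realType) (n : nat -> nat) (d : nat) (W : weights R d n)
    (x : 'cV[R]_(n 0%N)) :
  norm2 (hidden W x) <= (\prod_(i < d) spectral_norm (W i)) * norm2 x.
Proof.
elim: d W => [|d IHd] W; first by rewrite big_ord0 mul1r.
rewrite big_ord_recr/= mulrAC mulrC.
apply: le_trans (norm2_map_relu_le _) _; apply: le_trans (norm2_mulmx_le _ _) _.
by apply: ler_wpM2l; [exact: spectral_norm_ge0|exact: IHd (init_weights W)].
Qed.

Lemma layer_perturb_le (R : realType) m n (A E : 'M[R]_(m, n)) (h h' : 'cV[R]_n) :
  norm2 ((A + E) *m h' - A *m h)
    <= (spectral_norm A + spectral_norm E) * norm2 (h' - h)
       + spectral_norm E * norm2 h.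
Proof.
(* Splitting [A + E] on the vector [h' - h] requires only the triangle inequality for [norm2], not
   one for [spectral_norm]. *)
have -> : (A + E) *m h' - A *m h = A *m (h' - h) + E *m (h' - h) + E *m h.
  by rewrite mulmxDl !mulmxBr addrA subrK addrAC.
apply: le_trans (ler_norm2D _ _) _; rewrite mulrDl.
by rewrite lerD ?norm2_mulmx_le// (le_trans (ler_norm2D _ _))// lerD ?norm2_mulmx_le.
Qed.

(** * Propagation of the error through the layers *)

Section Perturbation.
Variables (R : realType) (n : nat -> nat) (c : R) (x : 'cV[R]_(n 0%N)).
Hypothesis c1 : 1 <= c.

(** [c] stands for 1 + 1/D with D the depth of the whole network. It stays fixed while the induction
    lowers [d], because the perturbations are measured against D. *)
Definition perturbation_bound (d : nat) (W U : weights R d n) : R :=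
  c ^+ d * norm2 x * (\prod_(i < d) spectral_norm (W i))
    * \sum_(i < d) (spectral_norm (U i) / spectral_norm (W i)).

(** Stated before any activation of the last layer, so that it serves both the linear output layer
    and, once the ReLU is removed by its Lipschitz bound, every hidden layer. *)
Lemma network_perturb_step (d : nat) (W U : weights R d.+1 n) :
  W ord_max != 0 ->
  spectral_norm (U ord_max) <= (c - 1) * spectral_norm (W ord_max) ->
  norm2 (hidden (init_weights (perturb W U)) x - hidden (init_weights W) x)
    <= perturbation_bound (init_weights W) (init_weights U) ->
  norm2 (network (perturb W U) x - network W x) <= perturbation_bound W U.
Proof.
move=> /spectral_norm_gt0 s0 us IH.
apply: le_trans (layer_perturb_le _ _ _ _) _.
have := hidden_le (init_weights W) x.
have := spectral_norm_ge0 (U ord_max).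
rewrite /perturbation_bound !big_ord_recr/=.
move: IH; rewrite /perturbation_bound.
set P := \prod_(i < d) _; set S := \sum_(i < d) _.
move: s0 us; set s := spectral_norm (W _); set u := spectral_norm (U _).
move=> s0 us IH u0 hP.
have P0 : 0 <= P by apply: prodr_ge0 => i _; exact: spectral_norm_ge0.
have cd : 1 <= c ^+ d.+1 by rewrite exprn_ege1.
(* The first summand absorbs the inherited error, amplified by [s + u <= c * s]; the second absorbs
   the new error [u * (P * norm2 x)], as [c ^+ d.+1] is at least 1. *)
have -> : c ^+ d.+1 * norm2 x * (P * s) * (S + u / s)
    = c * s * (c ^+ d * norm2 x * P * S) + c ^+ d.+1 * (u * (P * norm2 x)).
  by rewrite exprS; field; rewrite gt_eqF.
apply: lerD.
  by apply: ler_pM; rewrite ?norm2_ge0 ?addr_ge0 ?(ltW s0)//; lra.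
have uP : 0 <= u * (P * norm2 x) by rewrite !mulr_ge0 ?norm2_ge0.
apply: le_trans (ler_wpM2l u0 hP) _.
by rewrite ler_peMl.
Qed.

Lemma hidden_perturb_le (d : nat) (W U : weights R d n) :
  (forall i, W i != 0) ->
  (forall i, spectral_norm (U i) <= (c - 1) * spectral_norm (W i)) ->
  norm2 (hidden (perturb W U) x - hidden W x) <= perturbation_bound W U.
Proof.
elim: d W U => [|d IHd] W U W0 UW.
  by rewrite /perturbation_bound /= subrr norm20 big_ord0 mulr1 big_ord0 mulr0.
apply: le_trans (norm2_map_reluB_le _ _) _.
apply: network_perturb_step => //.
by apply: IHd => i; [exact: (W0 (widen_ord _ i))|exact: (UW (widen_ord _ i))].
Qed.

Lemma network_perturb_le (d : nat) (W U : weights R d n) :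
  (forall i, W i != 0) ->
  (forall i, spectral_norm (U i) <= (c - 1) * spectral_norm (W i)) ->
  norm2 (network (perturb W U) x - network W x) <= perturbation_bound W U.
Proof.
(* At depth 0 [network] and [hidden] are both the identity. *)
case: d W U => [|d] W U W0 UW; first exact: hidden_perturb_le.
apply: network_perturb_step => //.
by apply: hidden_perturb_le => i; [exact: (W0 (widen_ord _ i))|exact: (UW (widen_ord _ i))].
Qed.

End Perturbation.

(** * From (1 + 1/d)^d to e *)

Lemma expr_1Dinvn_le_e (R : realType) (d : nat) :
  (1 + d%:R^-1) ^+ d <= expR 1 :> R.
Proof.
case: d => [|d]; first by rewrite expr0 -[leLHS]expR0 ler_expR.
(* Writing the exponent 1 as depth times inverse depth makes e a power of the same degree, and
   [1 + t <= expR t] compares the bases. *)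
rewrite -[X in expR X](@mulfV _ (d.+1%:R : R)) ?pnatr_eq0// expRM_natl.
by rewrite lerXn2r ?nnegrE ?expR_ge0 ?expR_ge1Dx// addr_ge0// invr_ge0.
Qed.

Unset Implicit Arguments.

Theorem lemma2 (R : realType) (B : R) (hB : 0 < B) (d : nat) (hd : (1 <= d)%N)
    (n : nat -> nat) (hn : forall i : nat, (i <= d)%N -> (0 < n i)%N)
    (W : weights R d n) (hW : forall i : 'I_d, W i != 0)
    (x : 'cV[R]_(n 0%N)) (hx : input_domain B (n 0%N) x)
    (U : weights R d n)
    (hU : forall i : 'I_d,
        spectral_norm (U i) <= d%:R^-1 * spectral_norm (W i)) :
  norm2 (network (perturb W U) x - network W x)
    <= expR 1 * B * (\prod_(i < d) spectral_norm (W i))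
       * \sum_(i < d) (spectral_norm (U i) / spectral_norm (W i)).
Proof.
have dV0 : 0 <= d%:R^-1 :> R by rewrite invr_ge0.
have c1 : 1 <= 1 + d%:R^-1 :> R by rewrite lerDl.
have xB : norm2 x <= B.
  by rewrite -(@ler_pXn2r _ 2)// ?nnegrE ?norm2_ge0 ?(ltW hB)// sqr_norm2.
(* With [c] equal to 1 + 1/d, [c - 1] is the ratio allowed by [hU]. *)
apply: le_trans (network_perturb_le x c1 hW _) _.
  by move=> i; rewrite addrAC subrr add0r.
rewrite /perturbation_bound; apply: ler_wpM2r.
  by apply: sumr_ge0 => i _; rewrite divr_ge0 ?spectral_norm_ge0.
apply: ler_wpM2r; first by apply: prodr_ge0 => i _; exact: spectral_norm_ge0.
by apply: ler_pM; rewrite ?norm2_ge0 ?expr_1Dinvn_le_e ?exprn_ge0 ?addr_ge0.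
Qed.
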